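(* Let $F$ be an algebraically closed field of characteristic $0$, let $n\ge2$, $\Omega=\{1,\dots,n\}$, and let $\mathfrak{A}$ be the universal associative envelope of the anti-Jordan triple system of all $n\times n$ matrices over $F$, with generators $e_{i,j}$. For all $i,j,k,\ell\in\Omega$ the following identities hold in $\mathfrak{A}$. (1) $$e_{i,j}\cdot e_{k,\ell}=\delta_{j,k}\Big[\delta_{i,\ell}\Big\{\big(\delta_{i,1}+\widehat\delta_{i,1}\widehat\delta_{j,1}\big)e_{1,j}e_{j,1}+\big(\delta_{j,1}\widehat\delta_{i,1}+\widehat\delta_{i,1}\widehat\delta_{j,1}\big)e_{i,1}e_{1,i}-\widehat\delta_{i,1}\widehat\delta_{j,1}e_{1,1}^2\Big\}+\widehat\delta_{i,\ell}e_{i,1}e_{1,\ell}\Big]+\widehat\delta_{j,k}\delta_{i,\ell}e_{1,j}e_{k,1}.$$ (2) $$\begin{aligned}e_{i,j}\cdot e_{k,1}e_{1,\ell}=\;&\delta_{i,1}\Big[\Big(\delta_{j,k}\delta_{\ell,1}\big(\delta_{\ell,j}+\tfrac12\widehat\delta_{\ell,j}\big)+\tfrac12\widehat\delta_{j,k}\delta_{k,\ell}\delta_{j,1}\Big)e_{1,1}^3+\widehat\delta_{j,k}\delta_{k,\ell}\widehat\delta_{j,1}e_{1,1}^2e_{1,j}\\&+\delta_{j,k}\Big(2\delta_{\ell,j}\widehat\delta_{\ell,1}+\widehat\delta_{\ell,j}\big(\delta_{j,1}+\widehat\delta_{j,1}\widehat\delta_{\ell,1}\big)\Big)e_{1,1}^2e_{1,\ell}+\tfrac12\big(\delta_{\ell,1}\delta_{j,k}\widehat\delta_{\ell,j}-\widehat\delta_{j,k}\delta_{k,\ell}\delta_{j,1}\big)e_{1,1}\\&-\big(\delta_{j,k}\delta_{\ell,j}\widehat\delta_{\ell,1}+\widehat\delta_{j,k}\delta_{k,\ell}\widehat\delta_{j,1}\big)e_{1,j}\Big]+\widehat\delta_{i,1}\delta_{j,k}\big(e_{1,\ell}e_{1,1}e_{i,1}+e_{i,\ell}\big).\end{aligned}$$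 (3) $$\begin{aligned}e_{\ell,1}e_{1,k}\cdot e_{j,i}=\;&\delta_{i,1}\Big[\Big(\delta_{j,k}\delta_{\ell,1}\big(\delta_{\ell,j}+\tfrac12\widehat\delta_{\ell,j}\big)+\tfrac12\widehat\delta_{j,k}\delta_{k,\ell}\delta_{j,1}\Big)e_{1,1}^3+\widehat\delta_{j,k}\delta_{k,\ell}\widehat\delta_{j,1}e_{1,1}^2e_{j,1}\\&+\delta_{j,k}\Big(2\delta_{\ell,j}\widehat\delta_{\ell,1}+\widehat\delta_{\ell,j}\big(\delta_{j,1}+\widehat\delta_{j,1}\widehat\delta_{\ell,1}\big)\Big)\big(e_{1,1}^2e_{\ell,1}+e_{\ell,1}\big)+\tfrac12\big(\delta_{\ell,1}\delta_{j,k}\widehat\delta_{\ell,j}-\widehat\delta_{j,k}\delta_{k,\ell}\delta_{j,1}\big)e_{1,1}\\&-\delta_{j,k}\delta_{\ell,j}\widehat\delta_{\ell,1}e_{j,1}\Big]+\widehat\delta_{i,1}\delta_{j,k}\Big(\delta_{\ell,1}e_{1,1}^2e_{1,i}+\widehat\delta_{\ell,1}\big(e_{1,i}e_{1,1}e_{\ell,1}+e_{\ell,i}\big)\Big).\end{aligned}$$ (4) If $(k,\ell)\ne(1,1)$: $$\begin{aligned}e_{i,j}\cdot e_{1,k}e_{\ell,1}=\;&\delta_{j,1}\Big[\tfrac12\big(\delta_{i,k}\delta_{\ell,1}\widehat\delta_{i,1}+\widehat\delta_{i,k}\widehat\delta_{\ell,1}\delta_{k,\ell}\delta_{i,1}\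big)e_{1,1}^3+\widehat\delta_{i,k}\delta_{k,\ell}\widehat\delta_{i,1}\widehat\delta_{\ell,1}e_{1,1}^2e_{i,1}\\&+\delta_{i,k}\Big(\delta_{i,1}+\widehat\delta_{i,1}\widehat\delta_{\ell,1}\big(2\delta_{i,\ell}+\widehat\delta_{i,\ell}\big)\Big)e_{1,1}^2e_{\ell,1}+\tfrac12\big(\widehat\delta_{i,k}\widehat\delta_{\ell,1}\delta_{k,\ell}\delta_{i,1}-\delta_{i,k}\delta_{\ell,1}\widehat\delta_{i,1}\big)e_{1,1}\\&+\widehat\delta_{i,1}\widehat\delta_{\ell,1}\big(\delta_{i,k}\delta_{i,\ell}+\widehat\delta_{i,k}\delta_{k,\ell}\big)e_{i,1}\Big]+\widehat\delta_{j,1}\delta_{i,k}\Big(\delta_{\ell,1}\big(e_{1,1}^2e_{1,j}-e_{1,j}\big)+\widehat\delta_{\ell,1}e_{1,j}e_{1,1}e_{\ell,1}\Big).\end{aligned}$$ (5) If $(k,\ell)\ne(1,1)$: $$\begin{aligned}e_{1,\ell}e_{k,1}\cdot e_{j,i}=\;&\delta_{j,1}\Big[\tfrac12\big(\delta_{i,k}\delta_{\ell,1}\widehat\delta_{i,1}+\widehat\delta_{i,k}\widehat\delta_{\ell,1}\delta_{k,\ell}\delta_{i,1}\big)e_{1,1}^3+\widehat\delta_{i,k}\delta_{k,\ell}\widehat\delta_{i,1}\widehat\delta_{\ell,1}e_{1,1}^2e_{1,i}\\&+\delta_{i,k}\Big(\delta_{i,1}+\widehat\delta_{i,1}\wideh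at\delta_{\ell,1}\big(2\delta_{i,\ell}+\widehat\delta_{i,\ell}\big)\Big)\big(e_{1,1}^2e_{1,\ell}-e_{1,\ell}\big)+\tfrac12\big(\widehat\delta_{i,k}\widehat\delta_{\ell,1}\delta_{k,\ell}\delta_{i,1}-\delta_{i,k}\delta_{\ell,1}\widehat\delta_{i,1}\big)e_{1,1}\\&+\widehat\delta_{i,1}\widehat\delta_{\ell,1}\delta_{i,k}\delta_{i,\ell}e_{1,i}\Big]+\widehat\delta_{j,1}\delta_{i,k}\Big(\delta_{\ell,1}e_{1,1}^2e_{j,1}+\widehat\delta_{\ell,1}e_{1,\ell}e_{1,1}e_{j,1}\Big).\end{aligned}$$
   Context: $\delta_{i,j}$ is the Kronecker delta and $\widehat\delta_{i,j}=1-\delta_{i,j}$. The anti-Jordan triple system of all $n\times n$ matrices over $F$ has trilinear product $\langle a,b,c\rangle=abc-cba$. Its universal associative envelope is $\mathfrak{A}=F\langle X\rangle/I$, where $F\langle X\rangle$ is the free unital associative algebra on symbols $X=\{e_{i,j}\}_{i,j\in\Omega}$ (with $e_{i,j}$ corresponding to the matrix unit $E_{i,j}$), and $I$ is the two-sided ideal generated by all elements $e_{i,j}e_{k,\ell}e_{m,t}-e_{m,t}e_{k,\ell}e_{i,j}-\delta_{j,k}\delta_{\ell,m}e_{i,t}+\delta_{t,k}\delta_{\ell,i}e_{m,j}$ for $i,j,k,\ell,m,t\in\Omega$. The image of $e_{i,j}$ in $\mathfrak{A}$ is again denoted $e_{i,j}$. *)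

(* Defs.v *)
From HB Require Import structures.
From mathcomp Require Import all_boot all_order all_algebra.
From mathcomp Require Import generic_quotient ring_quotient.
From mathcomp Require Import monalg.
From mathcomp Require Import boolp.

Set Implicit Arguments.
Unset Strict Implicit.
Unset Printing Implicit Defensive.

Import GRing.Theory.
Local Open Scope ring_scope.
Local Open Scope quotient_scope.

Definition δ {F : pzRingType} {n : nat} (i j : 'I_n) : F := (i == j)%:R.

(* The complementary delta, \widehat\delta_{i,j} in the literature. *)
Definition δ' {F : pzRingType} {n : nat} (i j : 'I_n) : F := 1 - δ i j.

(* The two-sided ideal generated by S. *)
Inductive ideal_gen (A : pzRingType) (S : A -> Prop) : A -> Prop :=
| ideal_gen_mem x : S x -> ideal_gen S x
| ideal_gen0 : ideal_gen S 0
| ideal_genD x y : ideal_gen S x -> ideal_gen S y -> ideal_gen S (x + y)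
| ideal_genMl a x : ideal_gen S x -> ideal_gen S (a * x)
| ideal_genMr a x : ideal_gen S x -> ideal_gen S (x * a).

Definition ideal_pred (A : pzRingType) (S : A -> Prop) : {pred A} :=
  fun x => `[< ideal_gen S x >].

Lemma ideal_predP (A : pzRingType) (S : A -> Prop) x :
  reflect (ideal_gen S x) (x \in ideal_pred S).
Proof. exact: asboolP. Qed.

Lemma ideal_pred_zmod_closed (A : pzRingType) (S : A -> Prop) :
  zmod_closed (ideal_pred S).
Proof.
split=> [|x y /ideal_predP Ix /ideal_predP Iy]; apply/ideal_predP.
  exact: ideal_gen0.
by apply: ideal_genD => //; rewrite -mulN1r; apply: ideal_genMl.
Qed.

HB.instance Definition _ (A : pzRingType) (S : A -> Prop) :=
  GRing.isZmodClosed.Build A (ideal_pred S) (ideal_pred_zmod_closed S).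

(* F<X>, the free unital associative algebra: the monoid algebra of the free
   monoid on X. *)
Definition free_alg (F : comNzRingType) (X : choiceType) : Type :=
  {malg F[{fmonom X}]}.

HB.instance Definition _ (F : comNzRingType) (X : choiceType) :=
  GRing.Lalgebra.on (free_alg F X).

Lemma malg_scalerAr (F : comNzRingType) (M : monomType)
  (c : F) (x y : {malg F[M]}) : c *: (x * y) = x * (c *: y).
Proof.
have cC (g : {malg F[M]}) : malgC c * g = g * malgC c.
  rewrite !malgM_def fgmulUg fgmulgU.
  by apply: eq_bigr => k _; rewrite mul1m mulm1 mulrC.
by rewrite -!mul_malgC (mulrA x) -(cC x) mulrA.
Qed.

HB.instance Definition _ (F : comNzRingType) (X : choiceType) :=
  GRing.Lalgebra_isAlgebra.Build F (free_alg F X) (@malg_scalerAr F (fmonom X)).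

Definition free_gen (F : comNzRingType) (X : choiceType) (x : X) :
  free_alg F X := << fmu x >>.

Definition free_aug (F : comNzRingType) (X : choiceType) (y : free_alg F X) : F :=
  mcoeff mone y.

Section FreeAugmentation.
Variables (F : comNzRingType) (X : choiceType).
Implicit Types y z : free_alg F X.

Lemma free_augB y z : free_aug (y - z) = free_aug y - free_aug z.
Proof. exact: mcoeffB. Qed.

Lemma free_augD y z : free_aug (y + z) = free_aug y + free_aug z.
Proof. exact: mcoeffD. Qed.

Lemma free_augM y z : free_aug (y * z) = free_aug y * free_aug z.
Proof. exact: (mcoeff1g_is_multiplicative _ _).1. Qed.

Lemma free_augZ c y : free_aug (c *: y) = c * free_aug y.
Proof. exact: mcoeffZ. Qed.

Lemma free_aug1 : free_aug (1 : free_alg F X) = 1.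
Proof. by rewrite /free_aug mcoeff1 eqxx. Qed.

Lemma free_aug_gen x : free_aug (free_gen F (x : X)) = 0.
Proof. by rewrite /free_aug mcoeffU1 fm1_eq1. Qed.

End FreeAugmentation.

Section QuotientAlgebra.
Variables (F : comNzRingType) (A : algType F) (S : A -> Prop).

(* Properness of the ideal is required because an algType is nontrivial. *)
Definition quot_alg of ~ ideal_gen S 1 : Type := {ideal_quot (ideal_pred S)}.

Variable S_proper : ~ ideal_gen S 1.
Local Notation Q := (quot_alg S_proper).

HB.instance Definition _ := GRing.Zmodule.on Q.
HB.instance Definition _ := EqQuotient.on Q.

Lemma quot_alg_eqP (x y : A) : \pi_Q x = \pi_Q y <-> ideal_gen S (x - y).
Proof.
split=> [/eqP|Ixy]; first by rewrite -Quotient.idealrBE => /ideal_predP.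
by apply/eqP; rewrite -Quotient.idealrBE; apply/ideal_predP.
Qed.

Lemma quot_alg_reprP (x : A) : ideal_gen S (repr (\pi_Q x) - x).
Proof. by apply/quot_alg_eqP; rewrite reprK. Qed.

Definition quot_one : Q := \pi_Q 1.
Definition quot_mul := lift_op2 Q *%R.
Definition quot_scale (c : F) := lift_op1 Q (GRing.scale c).

Lemma quot_mulE x y : quot_mul (\pi_Q x) (\pi_Q y) = \pi_Q (x * y).
Proof.
unlock quot_mul; apply/quot_alg_eqP; set x' := repr _; set y' := repr _.
have -> : x' * y' - x * y = x' * (y' - y) + (x' - x) * y.
  by rewrite mulrBr mulrBl addrA subrK.
apply: ideal_genD; first exact/ideal_genMl/quot_alg_reprP.
exact/ideal_genMr/quot_alg_reprP.
Qed.

Lemma quot_scaleE c x : quot_scale c (\pi_Q x) = \pi_Q (c *: x).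
Proof.
unlock quot_scale; apply/quot_alg_eqP; rewrite -scalerBr -mulr_algl.
exact/ideal_genMl/quot_alg_reprP.
Qed.

Lemma quot_addE x y : \pi_Q x + \pi_Q y = \pi_Q (x + y).
Proof. by rewrite [RHS]Quotient.pi_add. Qed.

Let quotE := (quot_mulE, quot_scaleE, quot_addE).

Fact quot_mulA : associative quot_mul.
Proof. by move=> x y z; rewrite -[x]reprK -[y]reprK -[z]reprK !quotE mulrA. Qed.

Fact quot_mul1 : left_id quot_one quot_mul.
Proof. by move=> x; rewrite -[x]reprK !quotE mul1r. Qed.

Fact quot_mulr1 : right_id quot_one quot_mul.
Proof. by move=> x; rewrite -[x]reprK !quotE mulr1. Qed.

Fact quot_mulDl : left_distributive quot_mul +%R.
Proof. by move=> x y z; rewrite -[x]reprK -[y]reprK -[z]reprK !quotE mulrDl. Qed.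

Fact quot_mulDr : right_distributive quot_mul +%R.
Proof. by move=> x y z; rewrite -[x]reprK -[y]reprK -[z]reprK !quotE mulrDr. Qed.

Fact quot_one_neq0 : quot_one != 0.
Proof.
apply/eqP; have -> : 0 = \pi_Q 0 by rewrite [RHS]pi_zeror.
by move/quot_alg_eqP; rewrite subr0.
Qed.

HB.instance Definition _ := GRing.Zmodule_isNzRing.Build Q
  quot_mulA quot_mul1 quot_mulr1 quot_mulDl quot_mulDr quot_one_neq0.

Fact quot_scaleA a b x : quot_scale a (quot_scale b x) = quot_scale (a * b) x.
Proof. by rewrite -[x]reprK !quotE scalerA. Qed.

Fact quot_scale1 : left_id 1 quot_scale.
Proof. by move=> x; rewrite -[x]reprK !quotE scale1r. Qed.

Fact quot_scaleDr : right_distributive quot_scale +%R.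
Proof. by move=> c x y; rewrite -[x]reprK -[y]reprK !quotE scalerDr. Qed.

Fact quot_scaleDl x : {morph quot_scale^~ x : a b / a + b}.
Proof. by move=> a b /=; rewrite -[x]reprK !quotE scalerDl. Qed.

HB.instance Definition _ := GRing.Zmodule_isLmodule.Build F Q
  quot_scaleA quot_scale1 quot_scaleDr quot_scaleDl.

Fact quot_scaleAl c (x y : Q) : c *: (x * y) = (c *: x) * y.
Proof.
rewrite -[x]reprK -[y]reprK.
by rewrite /GRing.scale /GRing.mul /= !quotE scalerAl.
Qed.

HB.instance Definition _ := GRing.Lmodule_isLalgebra.Build F Q quot_scaleAl.

Fact quot_scaleAr c (x y : Q) : c *: (x * y) = x * (c *: y).
Proof.
rewrite -[x]reprK -[y]reprK.
by rewrite /GRing.scale /GRing.mul /= !quotE scalerAr.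
Qed.

HB.instance Definition _ := GRing.Lalgebra_isAlgebra.Build F Q quot_scaleAr.

Definition quot_pi (x : A) : Q := \pi_Q x.

Fact quot_pi_zmod_morphism : zmod_morphism quot_pi.
Proof. by move=> x y; rewrite /quot_pi [LHS]Quotient.pi_add Quotient.pi_opp. Qed.

HB.instance Definition _ :=
  GRing.isZmodMorphism.Build A Q quot_pi quot_pi_zmod_morphism.

Fact quot_pi_monoid_morphism : monoid_morphism quot_pi.
Proof. by split=> // x y; rewrite [RHS]quot_mulE. Qed.

HB.instance Definition _ :=
  GRing.isMonoidMorphism.Build A Q quot_pi quot_pi_monoid_morphism.

Fact quot_pi_scalable : scalable quot_pi.
Proof. by move=> c x; rewrite [RHS]quot_scaleE. Qed.

HB.instance Definition _ := GRing.isScalable.Build F A Q *:%R quot_pi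
  quot_pi_scalable.

Lemma quot_piP (x y : A) : quot_pi x = quot_pi y <-> ideal_gen S (x - y).
Proof. exact: quot_alg_eqP. Qed.

Lemma quot_pi_surj (z : Q) : exists x, z = quot_pi x.
Proof. by exists (repr z); rewrite /quot_pi reprK. Qed.

End QuotientAlgebra.

Definition ajt_prod (F : comNzRingType) (n : nat) (a b c : 'M[F]_n) : 'M[F]_n :=
  a *m b *m c - c *m b *m a.

Lemma ajt_prod_delta (F : comNzRingType) (n : nat) (i j k l m t : 'I_n) :
  ajt_prod (delta_mx i j) (delta_mx k l) (delta_mx m t) =
    (δ j k * δ l m) *: delta_mx i t - (δ t k * δ l i) *: delta_mx m j
    :> 'M[F]_n.
Proof.
rewrite /ajt_prod /δ !mul_delta_mx_cond -!scaler_nat -!scalemxAl.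
by rewrite !mul_delta_mx_cond -!scaler_nat !scalerA.
Qed.

Section Envelope.
Variables (F : fieldType) (n : nat).

Local Notation free := (free_alg F ('I_n * 'I_n)%type).
Local Notation x i j := (free_gen F (i, j) : free).

(* The last two terms are minus ajt_prod E_ij E_kl E_mt, read in the
   generators: see ajt_prod_delta. *)
Definition envelope_rel (i j k l m t : 'I_n) : free :=
  x i j * x k l * x m t - x m t * x k l * x i j
    - (δ j k * δ l m) *: x i t + (δ t k * δ l i) *: x m j.

Definition envelope_rels (r : free) : Prop :=
  exists i j k l m t : 'I_n, r = envelope_rel i j k l m t.

(* All the relators have zero constant term. *)
Lemma envelope_rels_proper : ~ ideal_gen envelope_rels 1.
Proof.
move=> I1; suff: free_aug (1 : free) = 0.
  by rewrite free_aug1 => /eqP; rewrite oner_eq0.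
elim: I1 => [_ [i [j [k [l [m [t ->]]]]]]||y z _ y0 _ z0|a y _ y0|a y _ y0].
- have aug0 (a b c d : free) : free_aug a = 0 -> free_aug b = 0 ->
      free_aug c = 0 -> free_aug d = 0 -> free_aug (a - b - c + d) = 0.
    by move=> a0 b0 c0 d0; rewrite free_augD 2!free_augB a0 b0 c0 d0 !subr0 addr0.
  apply: aug0.
  + by rewrite free_augM free_aug_gen mulr0.
  + by rewrite free_augM free_aug_gen mulr0.
  + by rewrite free_augZ free_aug_gen mulr0.
  + by rewrite free_augZ free_aug_gen mulr0.
- exact: mcoeff0.
- by rewrite free_augD y0 z0 addr0.
- by rewrite free_augM y0 mulr0.
- by rewrite free_augM y0 mul0r.
Qed.

Definition envelope : algType F := quot_alg envelope_rels_proper.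

Definition envelope_gen (i j : 'I_n) : envelope :=
  quot_pi envelope_rels_proper (x i j).

Local Notation e := envelope_gen.

Lemma envelope_gen_rel (i j k l m t : 'I_n) :
  e i j * e k l * e m t - e m t * e k l * e i j
    - (δ j k * δ l m) *: e i t + (δ t k * δ l i) *: e m j = 0.
Proof.
pose p := quot_pi envelope_rels_proper.
have pD a b : p (a + b) = p a + p b by apply: raddfD.
have pB a b : p (a - b) = p a - p b by apply: raddfB.
have pM a b : p (a * b) = p a * p b by apply: rmorphM.
have pZ c b : p (c *: b) = c *: p b by apply: linearZ.
have <- : p 0 = 0 by apply: raddf0.
have <- : p (envelope_rel i j k l m t) = p 0.
  apply/quot_piP; rewrite subr0; apply: ideal_gen_mem.
  by exists i, j, k, l, m, t.
by rewrite /envelope_rel pD 2!pB; congr (_ - _ - _ + _);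
   rewrite ?pZ // !(pM (x _ _ * x _ _)) !(pM (x _ _)).
Qed.

End Envelope.

(* Main.v *)
Require Import Defs.
From mathcomp Require Import all_boot all_order all_algebra.

Import GRing.Theory.
Local Open Scope ring_scope.

(** All five identities follow from a multiplication rule for products of two
    and of three generators, valid for any family e_ij in an associative algebra
    with 2 invertible that satisfies the defining relations

      abc - cba = <a,b,c>   for a, b, c among the e_ij.

    Degree two.  Reversing the first three factors of abcd and then the last
    three, or doing so in the opposite order, leads in both cases to cdab.  The
    corrections must agree, which is the quadratic relation [pair_rel]

      <a,b,c>d + c<b,a,d> = <a,d,c>b + a<b,c,d>.

    On matrix units it says that e_ij e_kl vanishes unless j = k or i = l, that
    e_ij e_jl with i <> l does not see j, that e_ij e_ki with j <> k does not see
    i, and that the products e_ij e_ji are additively separable in i and j.  This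
    is identity (1).

    Degree three.  Two matrix models of the relations are x |-> x and, once F
    contains a square root of -1, x |-> sqrt(-1) x^T.  Accordingly, for n >= 2,
    each generator splits as a sum e_il = u_il + v_il of a part that survives in
    the first model only and a part that survives in the second one only
    ([std_part] and [transp_part]), where u_il = e_ik e_km e_ml whenever k <> l
    or m <> i.  The main rule [triple_mul] is

      e_ij e_kl e_mt = d_jk d_lm u_it - d_il d_kt v_mj.

    The defining relation, applied to the same three factors, gives the v-parts
    from the u-parts; a word in neither of the two patterns contains, after a
    change of the free index in a product of two generators, two adjacent
    generators whose product is zero.

    Identities (2) to (5) compare two linear combinations of products of one or
    three generators: once these are expanded in the u_ij and v_ij, what is left
    is arithmetic with Kronecker deltas, done by comparing the indices. *)

(** * Kronecker deltas *)

Ltac simp_delta :=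
  rewrite ?(eqxx, mulr1n, mulr0n, subrr, mulr0, mul0r, mulr1, mul1r, scale0r,
    scaler0, scale1r, subr0, sub0r, mulNr, mulrN, addr0, add0r, oppr0).

(** Evaluates the deltas whose value is known from the inequalities of indices
    in the context; index equalities are meant to be substituted before. *)
Ltac decide_delta := rewrite /δ' /δ;
  repeat match goal with
  | H : is_true (?x != ?y) |- context [?x == ?y] => rewrite (negbTE H)
  | H : is_true (?x != ?y) |- context [?y == ?x] =>
      rewrite [y == x]eq_sym (negbTE H)
  end; simp_delta.

(** * Products of two generators *)

Section TripleSystem.

Variables (F : fieldType) (A : algType F) (n : nat) (e : 'I_n -> 'I_n -> A).

(** The triple product <E_ij, E_kl, E_mt> with matrix units read as
    generators; compare [ajt_prod_delta]. *)
Definition ajt_gen (i j k l m t : 'I_n) : A :=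
  (δ j k * δ l m) *: e i t - (δ t k * δ l i) *: e m j.

Hypothesis e_rel : forall i j k l m t : 'I_n,
  e i j * e k l * e m t - e m t * e k l * e i j
    - (δ j k * δ l m) *: e i t + (δ t k * δ l i) *: e m j = 0.
Hypothesis two_neq0 : 2 != 0 :> F.

Lemma triple_swap i j k l m t :
  e i j * e k l * e m t = e m t * e k l * e i j + ajt_gen i j k l m t.
Proof.
have /eqP := e_rel i j k l m t.
rewrite -addrA [- _ + _]addrC -[X in _ + X]opprB subr_eq0 subr_eq addrC.
by move/eqP.
Qed.

(** Both sides are the difference between e_ij e_kl e_mt e_rs and
    e_mt e_rs e_ij e_kl: on the left one first reverses the initial three
    factors and then the three after e_mt, on the right one first reverses the
    final three factors and then the initial three. *)
Lemma pair_rel i j k l m t r s :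
  ajt_gen i j k l m t * e r s + e m t * ajt_gen k l i j r s
  = ajt_gen i j r s m t * e k l + e i j * ajt_gen k l m t r s.
Proof.
apply: (@addrI _ (e m t * e r s * e i j * e k l)).
transitivity (e i j * e k l * e m t * e r s).
  rewrite (triple_swap i j) [RHS]mulrDl -(mulrA _ (e k l)).
  rewrite -(mulrA _ (e k l * _)) (triple_swap k l) [e m t * (_ + _)]mulrDr.
  by rewrite !mulrA -addrA [ajt_gen _ _ _ _ _ _ * _ + _]addrC.
rewrite -(mulrA _ (e k l)) -(mulrA _ (e k l * _)) (triple_swap k l).
rewrite [e i j * (_ + _)]mulrDr !mulrA (triple_swap i j).
by rewrite [(_ + ajt_gen _ _ _ _ _ _) * _]mulrDl addrA.
Qed.

Lemma double_eq0 (x : A) : x + x = 0 -> x = 0.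
Proof.
move=> xx0; apply/eqP; have := scaler_eq0 2 x.
by rewrite (negbTE two_neq0) /= => <-; rewrite scaler_nat mulr2n xx0.
Qed.

(** In each case a product of matrix units equal to one of the two factors is
    inserted into [pair_rel] so that all other terms vanish or repeat the
    product itself; the repetitions are where 2 has to be invertible. *)
Lemma pair_eq0 i j k l : j != k -> i != l -> e i j * e k l = 0.
Proof.
move=> neq_jk neq_il.
have [eq_kl | neq_kl] := eqVneq k l.
  subst l; have [eq_ij | neq_ij] := eqVneq i j.
    subst j; have := pair_rel i k k i i i k k.
    by rewrite /ajt_gen; decide_delta => /double_eq0.
  have := pair_rel i j j j j j k k.
  by rewrite /ajt_gen; decide_delta.
have [eq_ik | neq_ik] := eqVneq i k.
  subst k; have := pair_rel i j i i i i i l.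
  rewrite /ajt_gen; decide_delta => /eqP.
  by rewrite eq_sym -addr_eq0 => /eqP/double_eq0.
by have := pair_rel i j k k k k k l; rewrite /ajt_gen; decide_delta.
Qed.

(** Here [pair_rel] is applied to E_ij = E_ik E_kj E_jj and E_jl: when
    k <> j its only surviving terms come from (E_ik E_kj E_jj) E_jl and
    E_ik (E_kj E_jj E_jl). *)
Lemma pair_inner i j k l : i != l -> e i j * e j l = e i k * e k l.
Proof.
move=> neq_il; have [-> // | neq_jk] := eqVneq j k.
by have := pair_rel i k k j j j j l; rewrite /ajt_gen; decide_delta.
Qed.

(** The image of [pair_inner] under transposition, which changes the sign of
    the triple product. *)
Lemma pair_outer i j k l : j != k -> e i j * e k i = e l j * e k l.
Proof.
move=> neq_jk; have [-> // | neq_il] := eqVneq i l.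
have := pair_rel l j i l i i k i; rewrite /ajt_gen; decide_delta.
by move=> /oppr_inj.
Qed.

(** The substitution of [pair_inner] with l = i, where two terms more survive.
    What matters is that the right-hand side does not depend on i. *)
Lemma pair_diag i j k :
  e i j * e j i - e i k * e k i = e j j * e j j - e j k * e k j.
Proof.
have [->|neq_jk] := eqVneq j k; first by rewrite !subrr.
have := pair_rel i k k j j j j i; rewrite /ajt_gen; decide_delta.
by move/eqP; rewrite subr_eq addrAC -subr_eq [- _ + _]addrC => /eqP.
Qed.

Lemma pair_diag_sub i r j k :
  e i j * e j i - e i k * e k i = e r j * e j r - e r k * e k r.
Proof. by rewrite !pair_diag. Qed.

Lemma pair_diag_expand o i j :
  e i j * e j i = e o j * e j o + e i o * e o i - e o o * e o o.
Proof. by apply/eqP; rewrite addrAC -subr_eq (pair_diag_sub i o). Qed.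

Lemma pair_mul o i j k l :
  e i j * e k l =
    δ j k *: (δ i l *: ((δ i o + δ' i o * δ' j o) *: (e o j * e j o)
                        + (δ j o * δ' i o + δ' i o * δ' j o) *: (e i o * e o i)
                        - (δ' i o * δ' j o) *: e o o ^+ 2)
              + δ' i l *: (e i o * e o l))
    + (δ' j k * δ i l) *: (e o j * e k o).
Proof.
rewrite /δ'; have [<- | neq_jk] := eqVneq j k; last first.
  have [<- | neq_il] := eqVneq i l; decide_delta.
    exact: pair_outer.
  exact: pair_eq0.
have [<- | neq_il] := eqVneq i l; last first.
  by decide_delta; apply: pair_inner.
rewrite (pair_diag_expand o) /δ !eqxx !subrr mul0r !scale0r !addr0 !scale1r.
rewrite expr2.
have [->|_] := eqVneq i o; last have [->|_] := eqVneq j o.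
- by simp_delta; rewrite addrK.
- by simp_delta; rewrite addrAC subrr add0r.
- by simp_delta.
Qed.

(** * Products of three generators *)

Hypothesis n_ge2 : (2 <= n)%N.

Lemma exists_neq_index (i : 'I_n) : exists k, k != i.
Proof.
have /card_gt0P[k] : (0 < #|predC1 i|)%N.
  by rewrite cardC1 card_ord -subn1 subn_gt0.
by exists k.
Qed.

Definition other (i : 'I_n) : 'I_n := xchoose (exists_neq_index i).

Lemma other_neq i : other i != i.
Proof. exact: xchooseP (exists_neq_index i). Qed.

(** The component of e_il in the model x |-> x.  The word is one of the
    e_ik e_km e_ml of [triple_std]; the middle index m = l is arbitrary, while
    k <> l makes the word vanish in the model by transposes. *)
Definition std_part (i l : 'I_n) : A := e i (other l) * e (other l) l * e l l.

(** The component of e_il in the model x |-> sqrt(-1) x^T. *)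
Definition transp_part (i l : 'I_n) : A := e i l - std_part i l.

Lemma gen_split i l : e i l = std_part i l + transp_part i l.
Proof. by rewrite addrC subrK. Qed.

(** If k <> l the last two factors do not see m, and if m <> i the first two do
    not see k; as m can be made different from i and k different from l, each
    such word can be moved to the reference word of [std_part]. *)
Lemma triple_std i k m l :
  (k != l) || (m != i) -> e i k * e k m * e m l = std_part i l.
Proof.
have inner k' : k' != l -> e i k' * e k' m * e m l = std_part i l.
  move=> neq_kl; rewrite -mulrA (pair_inner k' m (other i) l) // mulrA.
  rewrite (pair_inner i k' (other l)) 1?eq_sym ?other_neq // -mulrA.
  by rewrite (pair_inner (other l) _ l) ?other_neq // mulrA.
case/orP=> [/inner // | neq_mi].
by rewrite (pair_inner i k (other l)) 1?eq_sym // inner ?other_neq.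
Qed.

(** The reversed words of [triple_std]: the triple product of its three factors
    is e_il, so reversal changes the standard part into minus the other one. *)
Lemma triple_transp i k m l :
  (k != l) || (m != i) -> e m l * e k m * e i k = - transp_part i l.
Proof.
move=> neq; rewrite opprB -(triple_std _ _ _ _ neq) [in RHS]triple_swap.
suff -> : ajt_gen i k k m m l = e i l by rewrite addrK.
by rewrite /ajt_gen; case/orP: neq => neq; decide_delta.
Qed.

(** Reversal says nothing about a palindrome.  Instead e_ik e_ki is rewritten,
    by the separability of diagonal products, through products in which i or k is
    replaced by a different index. *)
Lemma triple_palindrome i k :
  e i k * e k i * e i k = std_part i k - transp_part i k.
Proof.
set r := other i; set s := other k.
have -> : e i k * e k i = e i s * e s i + (e r k * e k r - e r s * e s r).
  by rewrite -(pair_diag_sub i) addrC subrK.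
rewrite !(mulrBl, mulrDl) triple_std ?other_neq //.
rewrite triple_transp ?other_neq ?orbT //.
by rewrite -[e r s * _ * _]mulrA [e s r * _]pair_eq0 ?other_neq // mulr0 subr0.
Qed.

(** If both patterns (j = k, l = m) and (i = l, k = t) fail, the word is zero:
    either two adjacent factors already multiply to zero, or their free index can
    be changed so that one of them annihilates the third factor. *)
Lemma triple_mul i j k l m t :
  e i j * e k l * e m t =
    (δ j k * δ l m) *: std_part i t - (δ i l * δ k t) *: transp_part m j.
Proof.
have [? | neq_jk] := eqVneq j k; have [? | neq_lm] := eqVneq l m;
  try subst k; try subst m.
- have [? | neq_il] := eqVneq i l; have [? | neq_jt] := eqVneq j t;
    try subst l; try subst t.
  + by rewrite triple_palindrome; decide_delta.
  + by decide_delta; rewrite triple_std ?neq_jt.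
  + by decide_delta; rewrite triple_std // [l == i]eq_sym neq_il orbT.
  + by decide_delta; rewrite triple_std ?neq_jt.
- have [? | neq_il] := eqVneq i l; have [? | neq_jt] := eqVneq j t;
    try subst l; try subst t.
  + by decide_delta; rewrite triple_transp // neq_lm orbT.
  + by decide_delta; rewrite -mulrA pair_eq0 ?mulr0.
  + decide_delta; rewrite (pair_inner i j (other j)) // -mulrA.
    by rewrite pair_eq0 ?other_neq ?mulr0.
  + by decide_delta; rewrite -mulrA pair_eq0 ?mulr0.
- have [? | neq_il] := eqVneq i l; have [? | neq_kt] := eqVneq k t;
    try subst l; try subst t.
  + by decide_delta; rewrite triple_transp // eq_sym neq_jk.
  + decide_delta; rewrite -mulrA (pair_inner k i (other i)) // mulrA.
    by rewrite pair_eq0 ?mul0r // eq_sym other_neq.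
  + by decide_delta; rewrite pair_eq0 ?mul0r.
  + by decide_delta; rewrite pair_eq0 ?mul0r.
- have [? | neq_il] := eqVneq i l; have [? | neq_kt] := eqVneq k t;
    try subst l; try subst t.
  + by decide_delta; rewrite triple_transp // neq_lm orbT.
  + by decide_delta; rewrite -mulrA pair_eq0 ?mulr0.
  + by decide_delta; rewrite pair_eq0 ?mul0r.
  + by decide_delta; rewrite pair_eq0 ?mul0r.
Qed.

End TripleSystem.

(** * Comparing the two components *)

Section LinearIdentities.

Variables (F : fieldType) (V : lmodType F).
Hypothesis two_neq0 : 2 != 0 :> F.
Implicit Types x y : V.

Lemma subr_addl x y : x - (x + y) = - y.
Proof. by rewrite opprD addrA subrr add0r. Qed.

Lemma addNr_add x y : - y + (x + y) = x.
Proof. by rewrite addrCA addNr addr0. Qed.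

Lemma half_sum x y : 2^-1 *: (x - y) + 2^-1 *: (x + y) = x.
Proof.
rewrite -scalerDr addrACA addNr addr0 -mulr2n -scaler_nat scalerA.
by rewrite mulVf // scale1r.
Qed.

Lemma half_diff x y : 2^-1 *: (x - y) + - 2^-1 *: (x + y) = - y.
Proof.
rewrite -[RHS](half_sum _ (- x)) opprK scaleNr -scalerN opprD.
by rewrite [x - y]addrC [- x - y]addrC.
Qed.

End LinearIdentities.

(** Splits on every comparison of two indices left in the goal and evaluates the
    deltas accordingly. *)
Ltac split_indices := rewrite /δ' /δ;
  repeat (match goal with
  | |- context [?x == ?y] =>
      first [ constr_eq x y; rewrite (eqxx x)
            | case: (eqVneq x y) => [?|?]; [try subst|] ]
  end; decide_delta).

(** After [split_indices] the two sides are combinations of a single standard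
    part, a single transposed part and their sum, with coefficients among
    0, 1, 2, 1/2 up to sign. *)
Ltac compare_components h2 :=
  rewrite ?(half_sum _ _ h2, half_diff _ _ h2, subr_addl, addNr_add) //
    scaler_nat mulr2n -addrA ?(subr_addl, addNr_add) // addrC.

(* The index 1 of Omega = {1, .., n} is the element o of 'I_n. *)
Theorem proposition4p2 (F : closedFieldType) (F_char0 : [pchar F] =i pred0)
    (n : nat) (n_ge2 : (2 <= n)%N) :
  let o : 'I_n := Ordinal (ltnW n_ge2) in
  let e : 'I_n -> 'I_n -> envelope F n := @envelope_gen F n in
  [/\ (forall i j k l : 'I_n,
        e i j * e k l =
        δ j k *: (δ i l *: ((δ i o + δ' i o * δ' j o) *: (e o j * e j o)
                            + (δ j o * δ' i o + δ' i o * δ' j o) *: (e i o * e o i)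
                            - (δ' i o * δ' j o) *: e o o ^+ 2)
                  + δ' i l *: (e i o * e o l))
        + (δ' j k * δ i l) *: (e o j * e k o)),
      (forall i j k l : 'I_n,
        e i j * (e k o * e o l) =
        δ i o *: ((δ j k * δ l o * (δ l j + 2^-1 * δ' l j)
                     + 2^-1 * δ' j k * δ k l * δ j o) *: e o o ^+ 3
                  + (δ' j k * δ k l * δ' j o) *: (e o o ^+ 2 * e o j)
                  + (δ j k * (2 * δ l j * δ' l o
                              + δ' l j * (δ j o + δ' j o * δ' l o)))
                      *: (e o o ^+ 2 * e o l)
                  + (2^-1 * (δ l o * δ j k * δ' l j - δ' j k * δ k l * δ j o))
                      *: e o o
                  - (δ j k * δ l j * δ' l o + δ' j k * δ k l * δ' j o) *: e o j)
        + (δ' i o * δ j k) *: (e o l * e o o * e i o + e i l)),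
      (forall i j k l : 'I_n,
        (e l o * e o k) * e j i =
        δ i o *: ((δ j k * δ l o * (δ l j + 2^-1 * δ' l j)
                     + 2^-1 * δ' j k * δ k l * δ j o) *: e o o ^+ 3
                  + (δ' j k * δ k l * δ' j o) *: (e o o ^+ 2 * e j o)
                  + (δ j k * (2 * δ l j * δ' l o
                              + δ' l j * (δ j o + δ' j o * δ' l o)))
                      *: (e o o ^+ 2 * e l o + e l o)
                  + (2^-1 * (δ l o * δ j k * δ' l j - δ' j k * δ k l * δ j o))
                      *: e o o
                  - (δ j k * δ l j * δ' l o) *: e j o)
        + (δ' i o * δ j k) *: (δ l o *: (e o o ^+ 2 * e o i)
                               + δ' l o *: (e o i * e o o * e l o + e l i))),
      (forall i j k l : 'I_n, (k, l) <> (o, o) ->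
        e i j * (e o k * e l o) =
        δ j o *: ((2^-1 * (δ i k * δ l o * δ' i o
                           + δ' i k * δ' l o * δ k l * δ i o)) *: e o o ^+ 3
                  + (δ' i k * δ k l * δ' i o * δ' l o) *: (e o o ^+ 2 * e i o)
                  + (δ i k * (δ i o + δ' i o * δ' l o * (2 * δ i l + δ' i l)))
                      *: (e o o ^+ 2 * e l o)
                  + (2^-1 * (δ' i k * δ' l o * δ k l * δ i o
                             - δ i k * δ l o * δ' i o)) *: e o o
                  + (δ' i o * δ' l o * (δ i k * δ i l + δ' i k * δ k l)) *: e i o)
        + (δ' j o * δ i k) *: (δ l o *: (e o o ^+ 2 * e o j - e o j)
                               + δ' l o *: (e o j * e o o * e l o)))
    & (forall i j k l : 'I_n, (k, l) <> (o, o) ->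
        (e o l * e k o) * e j i =
        δ j o *: ((2^-1 * (δ i k * δ l o * δ' i o
                           + δ' i k * δ' l o * δ k l * δ i o)) *: e o o ^+ 3
                  + (δ' i k * δ k l * δ' i o * δ' l o) *: (e o o ^+ 2 * e o i)
                  + (δ i k * (δ i o + δ' i o * δ' l o * (2 * δ i l + δ' i l)))
                      *: (e o o ^+ 2 * e o l - e o l)
                  + (2^-1 * (δ' i k * δ' l o * δ k l * δ i o
                             - δ i k * δ l o * δ' i o)) *: e o o
                  + (δ' i o * δ' l o * δ i k * δ i l) *: e o i)
        + (δ' j o * δ i k) *: (δ l o *: (e o o ^+ 2 * e j o)
                               + δ' l o *: (e o l * e o o * e j o)))].
Proof.
have two_neq0 : 2 != 0 :> F by rewrite (iffLR (pcharf0P F) F_char0).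
move=> o e.
have e_rel : forall i j k l m t : 'I_n,
    e i j * e k l * e m t - e m t * e k l * e i j
      - (δ j k * δ l m) *: e i t + (δ t k * δ l i) *: e m j = 0.
  exact: envelope_gen_rel.
(* Only the relations matter from here on; forgetting that the algebra is a
   quotient keeps the canonical structures of the rewriting steps small. *)
clearbody o e; move: (envelope F n) e e_rel => A e e_rel.
have mulT := triple_mul _ _ _ _ e_rel two_neq0 n_ge2.
have eE := gen_split _ _ _ e n_ge2.
split=> i j k l; first exact: pair_mul.
all: try move=> neq_kl; rewrite !exprS !expr0 !mulr1 !mulrA !mulT !eE.
all: split_indices => //; by compare_components two_neq0.
Qed.
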